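(* A general quadric surface $X=\{x\in\mathbb R^3\mid a_1x_1^2+a_2x_2^2+a_3x_3^2=1\}$ (with $a_1,a_2,a_3\in\mathbb R$ general) has $12$ complex umbilical points. The number of real umbilical points of $X$ is (i) $4$, if $X$ is an ellipsoid ($a_1,a_2,a_3$ are positive) or a two-sheeted hyperboloid (one of the $a_i$ is positive and two are negative); (ii) $0$, if $X$ is a one-sheeted hyperboloid (two of the $a_i$ are positive and one is negative) or empty ($a_1,a_2,a_3$ are negative).
   Context: ''General'' means that $(a_1,a_2,a_3)$ lies outside a proper Zariski closed subset of $\mathbb R^3$. For a real polynomial $f$ in $x=(x_1,x_2,x_3)$ let $\langle v,w\rangle=v^Tw$, let $\nabla f$ be the gradient, $\mathrm Hf$ the Hessian matrix, and $\eta(x)=\langle\nabla f(x),\nabla f(x)\rangle$. We write $\mathrm{Sing}(f)=\emptyset$ if $f=\partial f/\partial x_1=\partial f/\partial x_2=\partial f/\partial x_3=0$ has no solution in $\mathbb C^3$. For such $f$ with $X=\{f=0\}\subset\mathbb R^3$, the curvature variety is $$\mathcal C(f)=\{(x,\lambda,u,y)\in X\times\mathbb R\times\mathbb R^3\times\mathbb R^2 \mid \lambda^2\eta(x)=1,\ \langle u,\nabla f(x)\rangle=0,\ \langle u,u\rangle=1,\ \mathrm Hf(x)u+y_1u+y_2\nabla f(x)=0\},$$ with projection $\pi:\mathcal C(f)\to X$, $(x,\lambda,u,y)\mapsto x$. A point $x\in X$ is a (real) umbilical point if there exist $(x,\lambda,u,y),(x,\lambda',u',y')\in\pi^{-1}(x)$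 with $u'\neq\pm u$ and $y_1=y_1'$; let $U(f)$ be the set of these points. Let $\mathcal P_{3,2}$ be the space of real polynomials in three variables of degree at most $2$, put $$U_{3,2}=\bigcup_{f\in\mathcal P_{3,2}:\ \mathrm{Sing}(f)=\emptyset}\{f\}\times U(f)\ \subset\ \mathcal P_{3,2}\times\mathbb R^3,$$ and let $\overline{U_{3,2}}$ be its complex Zariski closure (in $(\mathcal P_{3,2}\otimes\mathbb C)\times\mathbb C^3$). A complex umbilical point of $X=\{f=0\}$ is a point $x\in\mathbb C^3$ with $(f,x)\in\overline{U_{3,2}}$. *)

(* Defs.v *)
From mathcomp Require Import all_boot all_order all_algebra.
From mathcomp Require Import boolp classical_sets functions cardinality reals.
From mathcomp Require Import complex mpoly.

Set Implicit Arguments.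
Unset Strict Implicit.
Unset Printing Implicit Defensive.

Import Order.TTheory GRing.Theory Num.Theory.
Local Open Scope ring_scope.
Local Open Scope classical_set_scope.

Section Zariski.
Variables (F : fieldType) (n : nat).

Definition mpeval (p : {mpoly F[n]}) (x : 'cV[F]_n) : F :=
  p.@[fun i => x i ord0].

Definition zariski_closed (Z : set 'cV[F]_n) : Prop :=
  exists S : set {mpoly F[n]}, Z = [set x | forall p, S p -> mpeval p x = 0].

Definition zariski_closure (A : set 'cV[F]_n) : set 'cV[F]_n :=
  [set x | forall Z, zariski_closed Z -> A `<=` Z -> Z x].

Definition for_general (P : 'cV[F]_n -> Prop) : Prop :=
  exists Z : set 'cV[F]_n,
    [/\ zariski_closed Z, Z <> setT & forall a, ~ Z a -> P a].

End Zariski.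

(* Affine coordinates on (polynomials of degree at most 2) x F^3: the ten
   coefficients at the monomials of degree < 3, then the coordinates of the
   point. *)
Definition pair_coords (F : fieldType) (f : {mpoly F[3]}) (x : 'cV[F]_3) :
    'cV[F]_(#|{: 'X_{1..3 < 3}}| + 3) :=
  col_mx (\col_j f@_(enum_val j : 'X_{1..3 < 3})) x.

Section Curvature.
Variable R : realType.
Implicit Types (f : {mpoly R[3]}) (x u v w : 'cV[R]_3).

Definition inner v w : R := (v^T *m w) ord0 ord0.

Definition gradient f x : 'cV[R]_3 := \col_i mpeval f^`M(i) x.

Definition hessian f x : 'M[R]_3 := \matrix_(i, j) mpeval f^`M(i)^`M(j) x.

Definition eta f x : R := inner (gradient f x) (gradient f x).

Definition complexify_poly f : {mpoly R[i][3]} :=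
  map_mpoly (real_complex R) f.

Definition complexify_point x : 'cV[R[i]]_3 := map_mx (real_complex R) x.

Definition sing f : set 'cV[R[i]]_3 :=
  [set z | mpeval (complexify_poly f) z = 0
         /\ forall i, mpeval (complexify_poly f)^`M(i) z = 0].

Definition real_locus f : set 'cV[R]_3 := [set x | mpeval f x = 0].

Record cv_point := CVPoint {
  cv_x : 'cV[R]_3;
  cv_lambda : R;
  cv_u : 'cV[R]_3;
  cv_y : 'cV[R]_2 }.

Definition cv_y1 (c : cv_point) : R := cv_y c ord0 ord0.
Definition cv_y2 (c : cv_point) : R := cv_y c ord_max ord0.

Definition curvature_variety f : set cv_point :=
  [set c | [/\ real_locus f (cv_x c),
               cv_lambda c ^+ 2 * eta f (cv_x c) = 1,
               inner (cv_u c) (gradient f (cv_x c)) = 0,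
               inner (cv_u c) (cv_u c) = 1
             & hessian f (cv_x c) *m cv_u c + cv_y1 c *: cv_u c
               + cv_y2 c *: gradient f (cv_x c) = 0]].

Definition umbilical_points f : set 'cV[R]_3 :=
  [set x | exists c c' : cv_point,
     [/\ curvature_variety f c /\ cv_x c = x,
         curvature_variety f c' /\ cv_x c' = x,
         cv_u c' <> cv_u c,
         cv_u c' <> - cv_u c
       & cv_y1 c = cv_y1 c']].

Definition U32 : set ({mpoly R[3]} * 'cV[R]_3) :=
  [set fx | [/\ (msize fx.1 <= 3)%N, sing fx.1 = set0
              & umbilical_points fx.1 fx.2]].

Definition U32_closure : set 'cV[R[i]]_(#|{: 'X_{1..3 < 3}}| + 3) :=
  zariski_closure
    [set pair_coords (complexify_poly fx.1) (complexify_point fx.2)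
    | fx in U32].

Definition complex_umbilical_points f : set 'cV[R[i]]_3 :=
  [set z | U32_closure (pair_coords (complexify_poly f) z)].

Definition quadric (a : 'cV[R]_3) : {mpoly R[3]} :=
  (\sum_(i < 3) a i ord0 *: 'X_i ^+ 2) - 1.

Definition num_pos (a : 'cV[R]_3) : nat := #|[set i | 0 < a i ord0]%SET|.
Definition num_neg (a : 'cV[R]_3) : nat := #|[set i | a i ord0 < 0]%SET|.

Definition ellipsoid (a : 'cV[R]_3) := num_pos a = 3%N.
Definition two_sheeted_hyperboloid (a : 'cV[R]_3) :=
  num_pos a = 1%N /\ num_neg a = 2%N.
Definition one_sheeted_hyperboloid (a : 'cV[R]_3) :=
  num_pos a = 2%N /\ num_neg a = 1%N.
Definition empty_quadric (a : 'cV[R]_3) := num_neg a = 3%N.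

End Curvature.

(* Main.v *)
Require Import Defs.
From mathcomp Require Import all_boot all_order all_algebra.
From mathcomp Require Import boolp classical_sets functions cardinality reals.
From mathcomp Require Import complex mpoly ring.

(* At an umbilical point of {f = 0} the Hessian restricted to the tangent plane
   is a multiple of the metric; the 2 x 2 minors expressing this are polynomial
   in (f, x), so they also vanish on the Zariski closure.  For the quadric
   sum a_l x_l^2 = 1 they force x_i = 0 for some i and then determine the
   squares of the two other coordinates, which leaves 3 * 4 points.
   Conversely each of these points z is a limit in the Zariski sense of real
   ones: moving the point along the line Re z + t Im z, and the coefficients
   polynomially along with it, gives a curve which lies in U_{3,2} for almost
   all real t and passes through (f, z) at t = i.
   The square of x_j (j <> i) has the sign of a_1 a_2 a_3 (a_j - a_i)(a_j - a_k),
   so the points with x_i = 0 are real exactly when a_1 a_2 a_3 > 0 and a_i lies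
   between the two other coefficients. *)

Set Implicit Arguments.
Unset Strict Implicit.
Unset Printing Implicit Defensive.

Import Order.TTheory GRing.Theory Num.Theory.
Local Open Scope ring_scope.

(* Addition in ['I_3] is modulo 3: [i], [i + 1], [i + 2] are the three indices. *)
Lemma ord3_ind (P : 'I_3 -> Prop) i : P i -> P (i + 1) -> P (i + 2) -> forall l, P l.
Proof.
move=> P0 P1 P2 l.
have: [|| l == i, l == i + 1 | l == i + 2].
  by move: i l {P0 P1 P2} => [[|[|[|?]]] ?] [[|[|[|?]]] ?].
by case/or3P => /eqP ->.
Qed.

Lemma big_ord3 (V : nmodType) (F : 'I_3 -> V) i :
  \sum_l F l = F i + F (i + 1) + F (i + 2).
Proof.
rewrite !big_ord_recl big_ord0 addr0 addrA.
case: i => -[|[|[|//]]] Hi; [|rewrite -addrA addrC|rewrite addrC addrA];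
  by congr (F _ + F _ + F _); apply/val_inj.
Qed.

Lemma ord3_neq (i : 'I_3) :
  ((i + 1 == i = false)%R * (i + 2 == i = false)%R * (i == i + 1 = false)%R
   * (i == i + 2 = false)%R * (i + 1 == i + 2 = false)%R
   * (i + 2 == i + 1 = false)%R)%type.
Proof. by move: i; case=> -[|[|[|//]]]. Qed.

Lemma ord3_add (i : 'I_3) :
  ((i + 1 + 1 = i + 2)%R * (i + 1 + 2 = i)%R * (i + 2 + 1 = i)%R
   * (i + 2 + 2 = i + 1)%R)%type.
Proof. by move: i; case=> -[|[|[|//]]] ?; do !split; apply/val_inj. Qed.

Lemma cv3P (T : Type) (x y : 'cV[T]_3) i :
  x i ord0 = y i ord0 -> x (i + 1) ord0 = y (i + 1) ord0 ->
  x (i + 2) ord0 = y (i + 2) ord0 -> x = y.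
Proof. by move=> H0 H1 H2; apply/colP; apply: (ord3_ind H0). Qed.

(** * Tangent vectors and the umbilic minors *)

Section CrossProducts.
Variable F : comRingType.
Implicit Types (n h : 'I_3 -> F) (H : 'I_3 -> 'I_3 -> F).

(* The cross products of [n] with the basis vectors span the tangent plane
   orthogonal to [n]. *)
Definition cross_basis n (p q : 'I_3) : F :=
  if q == p + 1 then n (p + 2) else if q == p + 2 then - n (p + 1) else 0.

Definition cross_form H n (p q : 'I_3) : F :=
  \sum_l \sum_m cross_basis n p l * H l m * cross_basis n q m.

Definition cross_gram n (p q : 'I_3) : F :=
  \sum_l cross_basis n p l * cross_basis n q l.

(** Proportionality of the Hessian form and the metric on the cross products, with the unknown
    factor eliminated: only the Hessian and the gradient occur, and the expression is polynomial in
    them. *)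
Definition umbilic_minor H n (p q r s : 'I_3) : F :=
  cross_form H n p q * cross_gram n r s - cross_form H n r s * cross_gram n p q.

Lemma cross_basisE n p :
  [/\ cross_basis n p p = 0, cross_basis n p (p + 1) = n (p + 2)
    & cross_basis n p (p + 2) = - n (p + 1)].
Proof.
by rewrite /cross_basis !eqxx !ord3_neq.
Qed.

Lemma cross_form_diag (h : 'I_3 -> F) n p q :
  cross_form (fun l m => h l *+ (l == m)) n p q =
  \sum_l cross_basis n p l * h l * cross_basis n q l.
Proof.
apply: eq_bigr => l _; rewrite (bigD1 l) //= eqxx big1 ?addr0 // => m /negPf Hm.
by rewrite eq_sym Hm mulr0 mul0r.
Qed.

Lemma cross_basis_orth n p : \sum_l cross_basis n p l * n l = 0.
Proof.
rewrite (big_ord3 _ p); case: (cross_basisE n p) => -> -> ->; ring.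
Qed.

End CrossProducts.

(* The umbilic equations of the quadric [\sum_l a l * x l ^+ 2 = b] in the
   coordinate plane [x_i = 0]. *)
Definition umbilic_on (F : pzRingType) (a x : 'I_3 -> F) (b : F) (i : 'I_3) :=
  [/\ x i = 0,
      a (i + 1) * x (i + 1) ^+ 2 + a (i + 2) * x (i + 2) ^+ 2 = b
    & a i * (a (i + 1) ^+ 2 * x (i + 1) ^+ 2 + a (i + 2) ^+ 2 * x (i + 2) ^+ 2)
      = b * (a (i + 1) * a (i + 2))].

(** * The umbilic equations of a diagonal quadric *)

Section DiagonalUmbilics.
Variable F : numFieldType.
Variables a x : 'I_3 -> F.
Hypothesis a_neq0 : forall i, a i != 0.
Hypothesis a_inj : injective a.

Let h l : F := 2 * a l.
Let n l : F := 2 * a l * x l.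

Lemma umbilic_on_of_minors :
    (forall p q r s, umbilic_minor (fun l m => h l *+ (l == m)) n p q r s = 0) ->
    \sum_l a l * x l ^+ 2 = 1 ->
  exists i, umbilic_on a x 1 i.
Proof.
move=> E S.
have two0 : (2 : F) != 0 by rewrite pnatr_eq0.
have: x 0 = 0 \/ x (0 + 1) = 0 \/ x (0 + 2) = 0.
  have := E 0 (0 + 1) 0 (0 + 2).
  rewrite /umbilic_minor /cross_gram !cross_form_diag !(big_ord3 _ 0).
  case: (cross_basisE n 0) => -> -> ->.
  case: (cross_basisE n (0 + 1)); case: (cross_basisE n (0 + 2)).
  rewrite !ord3_add => -> -> -> -> -> ->.
  move=> Z.
  (* This minor factors completely. As the [a l] are nonzero and distinct, one of the three
     coordinates has to vanish. *)
  have: (h (0 + 2) - h (0 + 1)) * n 0 ^+ 2 * n (0 + 1) * n (0 + 2) = 0.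
    by rewrite -[RHS]Z; ring.
  move/eqP; rewrite /n /h !(mulf_eq0, expf_eq0) /= !(negPf two0) !(negPf (a_neq0 _)) /=.
  rewrite -mulrBr mulf_eq0 (negPf two0) subr_eq0 /= (inj_eq a_inj) !ord3_neq /=.
  by case/orP=> [/orP[/orP[]|]|] /eqP ->; tauto.
have key i : x i = 0 -> umbilic_on a x 1 i.
  move=> xi; split => //; first by move: S; rewrite (big_ord3 _ i) xi; move=> <-; ring.
  (* When [n i = 0], the minors that compare the direction [i] with [i + 1] and with [i + 2] are [B]
     times the square of a gradient coordinate. Both squares cannot vanish on the quadric, so
     [B = 0]. *)
  set B := h (i + 1) * n (i + 2) ^+ 2 + h (i + 2) * n (i + 1) ^+ 2
           - h i * (n (i + 1) ^+ 2 + n (i + 2) ^+ 2).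
  have ni : n i = 0 by rewrite /n xi mulr0.
  have B2 : n (i + 2) ^+ 2 * B = 0.
    have := E i i (i + 1) (i + 1).
    rewrite /umbilic_minor /cross_gram !cross_form_diag !(big_ord3 _ i).
    case: (cross_basisE n i) => -> -> ->.
    case: (cross_basisE n (i + 1)); rewrite !ord3_add => -> -> ->.
    by rewrite ni /B => Z; rewrite -[RHS]Z; ring.
  have B1 : n (i + 1) ^+ 2 * B = 0.
    have := E i i (i + 2) (i + 2).
    rewrite /umbilic_minor /cross_gram !cross_form_diag !(big_ord3 _ i).
    case: (cross_basisE n i) => -> -> ->.
    case: (cross_basisE n (i + 2)); rewrite !ord3_add => -> -> ->.
    by rewrite ni /B => Z; rewrite -[RHS]Z; ring.
  have S' : a (i + 1) * x (i + 1) ^+ 2 + a (i + 2) * x (i + 2) ^+ 2 = 1.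
    by move: S; rewrite (big_ord3 _ i) xi; move=> <-; ring.
  have B0 : B = 0.
    apply/eqP; apply/negPn/negP => Bn.
    have nz l : n l ^+ 2 * B = 0 -> x l = 0.
      move/eqP; rewrite mulf_eq0 (negPf Bn) orbF expf_eq0 /= /n.
      by rewrite !mulf_eq0 (negPf two0) (negPf (a_neq0 _)) => /eqP.
    move: S'; rewrite (nz _ B1) (nz _ B2) => /eqP.
    by rewrite expr0n /= !mulr0 addr0 eq_sym oner_eq0.
  (* Every term of [B] carries three factors 2, one from [h] and two from the square of [n]. *)
  have e8 : (8 : F) != 0 by rewrite pnatr_eq0.
  apply: (mulfI e8); rewrite -[X in _ = _ * (X * _)]S'; apply/eqP.
  by rewrite eq_sym -subr_eq0 -[X in _ == X]B0 /B /h /n; apply/eqP; ring.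
by case=> [|[]] /key; eauto.
Qed.

End DiagonalUmbilics.

Section SquaredCoordinates.
Variable F : fieldType.
Variables a : 'I_3 -> F.
Hypothesis a_neq0 : forall i, a i != 0.
Hypothesis a_inj : injective a.

(** Cramer's solution of the two equations of [umbilic_on] with [b = 1], which are linear in the
    squares of the coordinates [i + 1] and [i + 2]; up to sign their determinant is [a i * a (i + 1)
    * a (i + 2) * (a (i + 1) - a (i + 2))]. *)
Definition umbilic_sqr (i : 'I_3) : F * F :=
  (a (i + 2) * (a (i + 1) - a i) / (a (i + 1) * a i * (a (i + 1) - a (i + 2))),
   a (i + 1) * (a (i + 2) - a i) / (a (i + 2) * a i * (a (i + 2) - a (i + 1)))).

Lemma subr_inj_eq0 k l : (a k - a l == 0) = (k == l).
Proof. by rewrite subr_eq0 (inj_eq a_inj). Qed.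

Lemma umbilic_onE (x : 'I_3 -> F) i : umbilic_on a x 1 i <->
  [/\ x i = 0, x (i + 1) ^+ 2 = (umbilic_sqr i).1
    & x (i + 2) ^+ 2 = (umbilic_sqr i).2].
Proof.
have H12 : a (i + 1) - a (i + 2) != 0 by rewrite subr_inj_eq0 !ord3_neq.
have H21 : a (i + 2) - a (i + 1) != 0 by rewrite subr_inj_eq0 !ord3_neq.
have A0 := a_neq0 i; have A1 := a_neq0 (i + 1); have A2 := a_neq0 (i + 2).
rewrite /umbilic_on /umbilic_sqr /=; set X := _ ^+ 2; set Z := x (i + 2) ^+ 2.
split=> -[x0 e1 e2]; split=> //.
- have N : a (i + 1) * a i * (a (i + 1) - a (i + 2)) != 0 by rewrite !mulf_neq0.
  apply: (mulIf N); rewrite divfK //.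
  have -> : X * (a (i + 1) * a i * (a (i + 1) - a (i + 2))) =
    a i * (a (i + 1) ^+ 2 * X + a (i + 2) ^+ 2 * Z)
    - a i * a (i + 2) * (a (i + 1) * X + a (i + 2) * Z) by ring.
  by rewrite e1 e2; ring.
- have N : a (i + 2) * a i * (a (i + 2) - a (i + 1)) != 0 by rewrite !mulf_neq0.
  apply: (mulIf N); rewrite divfK //.
  have -> : Z * (a (i + 2) * a i * (a (i + 2) - a (i + 1))) =
    a i * (a (i + 1) ^+ 2 * X + a (i + 2) ^+ 2 * Z)
    - a i * a (i + 1) * (a (i + 1) * X + a (i + 2) * Z) by ring.
  by rewrite e1 e2; ring.
- by rewrite e1 e2; field; rewrite A0 A1 A2 H12 H21.
- by rewrite e1 e2; field; rewrite A0 A1 A2 H12 H21.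
Qed.

Lemma umbilic_sqr_neq0 i : ((umbilic_sqr i).1 != 0) && ((umbilic_sqr i).2 != 0).
Proof.
rewrite /umbilic_sqr /= !(mulf_eq0, invr_eq0) !subr_inj_eq0.
by rewrite !(negPf (a_neq0 _)) !ord3_neq.
Qed.

End SquaredCoordinates.

(** * Diagonal quadrics and their derivatives *)

Definition diag_quadric (F : fieldType) (a : 'I_3 -> F) (b : F) : {mpoly F[3]} :=
  (\sum_l a l *: 'X_l ^+ 2) - b%:MP.

Lemma mderiv_var (F : fieldType) n (i l : 'I_n) :
  ('X_i : {mpoly F[n]})^`M(l) = (i == l)%:R.
Proof.
rewrite mderivX mnm1E; case: eqP => [->|_]; last exact: scale0r.
have -> : (U_(l) - U_(l) = 0 :> 'X_{1..n})%MM.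
  by apply/mnmP => k; rewrite mnmBE subnn mnm0E.
by rewrite mpolyX0 scale1r.
Qed.

Section DiagQuadric.
Variables (F : fieldType) (a : 'I_3 -> F) (b : F).
Let f := diag_quadric a b.

Lemma mpeval_diag_quadric x :
  mpeval f x = \sum_l a l * x l ord0 ^+ 2 - b.
Proof.
rewrite /mpeval mevalB mevalC raddf_sum /=; congr (_ - _); apply: eq_bigr => l _.
by rewrite mevalZ rmorphXn /= mevalXU.
Qed.

Lemma mderiv_diag_quadric l : f^`M(l) = (2 * a l) *: 'X_l.
Proof.
rewrite mderivB mderivC subr0 raddf_sum /= (bigD1 l) //= big1 ?addr0.
  rewrite mderivZ expr2 mderivM mderiv_var eqxx mul1r mulr1 -mulr2n.
  by rewrite -scaler_nat scalerA mulrC.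
move=> m /negPf Hm; rewrite mderivZ expr2 mderivM mderiv_var Hm.
by rewrite mul0r mulr0 addr0 scaler0.
Qed.

Lemma mpeval_mderiv_diag_quadric l x : mpeval f^`M(l) x = 2 * a l * x l ord0.
Proof. by rewrite mderiv_diag_quadric /mpeval mevalZ mevalXU. Qed.

Lemma mpeval_mderiv2_diag_quadric l m x :
  mpeval f^`M(l)^`M(m) x = (2 * a l) *+ (l == m).
Proof.
rewrite mderiv_diag_quadric mderivZ mderiv_var /mpeval mevalZ -mpolyC_nat mevalC.
by rewrite mulr_natr.
Qed.

Lemma msize_diag_quadric : (msize f <= 3)%N.
Proof.
rewrite (leq_trans (mmeasureD_le _ _ _)) // geq_max mmeasureN mmeasureC.
rewrite (leq_trans (leq_b1 _)) // andbT.
rewrite (leq_trans (mmeasure_sum _ _ _ _)) //; apply/bigmax_leqP => l _.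
rewrite (leq_trans (mmeasureZ_le _ _ _)) //.
by rewrite mpolyXn mmeasureX /= mdegMn mdeg1.
Qed.

End DiagQuadric.

Lemma quadricE (R : realType) (a : 'cV[R]_3) :
  quadric a = diag_quadric (fun l => a l ord0) 1.
Proof. by rewrite /quadric /diag_quadric mpolyC1. Qed.

Lemma complexify_diag_quadric (R : realType) (a : 'I_3 -> R) b :
  complexify_poly (diag_quadric a b) =
  diag_quadric (fun l => (a l)%:C%C) (b%:C)%C.
Proof.
rewrite /complexify_poly /diag_quadric rmorphB /= map_mpolyC rmorph_sum /=.
congr (_ - _); apply: eq_bigr => l _.
by rewrite map_mpolyZ rmorphXn /= map_mpolyX.
Qed.

Lemma innerE (R : realType) (v w : 'cV[R]_3) :
  inner v w = \sum_l v l ord0 * w l ord0.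
Proof. by rewrite /inner mxE; apply: eq_bigr => l _; rewrite mxE. Qed.

(** * Linear algebra in the tangent plane at a real umbilical point *)

Section TangentPlane.
Variable F : realFieldType.
Implicit Types u v w n : 'I_3 -> F.

Definition dot u v : F := \sum_l u l * v l.

Definition det3 u v w : F :=
  u 0 * (v (0 + 1) * w (0 + 2) - v (0 + 2) * w (0 + 1))
  - u (0 + 1) * (v 0 * w (0 + 2) - v (0 + 2) * w 0)
  + u (0 + 2) * (v 0 * w (0 + 1) - v (0 + 1) * w 0).

Lemma dotE u v :
  dot u v = u 0 * v 0 + u (0 + 1) * v (0 + 1) + u (0 + 2) * v (0 + 2).
Proof. exact: big_ord3. Qed.

(** The Gram determinant. *)
Lemma det3_gram u v w :
  det3 u v w ^+ 2 =
  dot u u * dot v v * dot w w + 2 * dot u v * dot v w * dot u w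
  - dot u u * dot v w ^+ 2 - dot v v * dot u w ^+ 2 - dot w w * dot u v ^+ 2.
Proof. by rewrite !dotE /det3; ring. Qed.

Lemma det3_cramer u v n w l :
  det3 u v n * w l = det3 w v n * u l + det3 u w n * v l + det3 u v w * n l.
Proof.
by move: l; apply: (@ord3_ind _ 0); rewrite /det3; ring.
Qed.

(** This is Cramer's relation between four vectors of 3-space, paired with [n]. It shows that three
    vectors orthogonal to a non-isotropic [n] are dependent. *)
Lemma det3_dot u v w n :
  det3 u v w * dot n n =
  dot n w * det3 u v n + dot n u * det3 v w n + dot n v * det3 w u n.
Proof. by rewrite !dotE /det3; ring. Qed.

Lemma dot_self_eq0 u : dot u u = 0 -> forall l, u l = 0.
Proof.
move=> H l; have := psumr_eq0P _ H => /(_ (fun i _ => sqr_ge0 (u i)) l isT).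
by move/eqP; rewrite mulf_eq0 orbb => /eqP.
Qed.

Variables (n u v : 'I_3 -> F).
Hypotheses (n_neq0 : dot n n != 0) (un : dot u n = 0) (vn : dot v n = 0).
Hypotheses (uu : dot u u = 1) (vv : dot v v = 1).
Hypotheses (vNu : ~ v =1 u) (vNNu : ~ v =1 (fun l => - u l)).

(** If the determinant vanished, the Gram identity would give [dot u v ^+ 2 = 1], the equality case
    of Cauchy-Schwarz, and the unit vectors would agree up to sign. *)
Lemma tangent_det_neq0 : det3 u v n != 0.
Proof.
apply/eqP => D0; have := det3_gram u v n.
rewrite D0 un vn uu vv !expr0n /= !(mulr0, mul1r, mulr1, subr0, addr0).
move=> E.
have c1 : dot u v ^+ 2 = 1.
  by apply: (mulfI n_neq0); apply/eqP; rewrite eq_sym mulr1 -subr_eq0 -E.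
move/eqP: c1; rewrite sqrf_eq1 => /orP[/eqP c1|/eqP c1].
  apply: vNu => l; apply/eqP; rewrite -subr_eq0; apply/eqP; move: l.
  apply: (dot_self_eq0 (u := fun l => v l - u l)).
  have -> : dot (fun l => v l - u l) (fun l => v l - u l) =
    dot v v - 2 * dot u v + dot u u by rewrite !dotE; ring.
  by rewrite uu vv c1; ring.
apply: vNNu => l; apply/eqP; rewrite -subr_eq0 opprK; apply/eqP; move: l.
apply: (dot_self_eq0 (u := fun l => v l + u l)).
have -> : dot (fun l => v l + u l) (fun l => v l + u l) =
  dot v v + 2 * dot u v + dot u u by rewrite !dotE; ring.
by rewrite uu vv c1; ring.
Qed.

Lemma tangent_span w : dot w n = 0 ->
  exists b c, forall l, w l = b * u l + c * v l.
Proof.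
move=> wn; have D := tangent_det_neq0.
have g0 : det3 u v w = 0.
  apply: (mulIf n_neq0); rewrite mul0r det3_dot.
  have dC (x y : 'I_3 -> F) : dot x y = dot y x by rewrite !dotE; ring.
  by rewrite (dC n w) (dC n u) (dC n v) wn un vn; ring.
exists (det3 w v n / det3 u v n), (det3 u w n / det3 u v n) => l.
apply: (mulfI D); rewrite det3_cramer g0 mul0r addr0.
by field.
Qed.

Variables (H : 'I_3 -> 'I_3 -> F) (t y z : F).
Hypothesis Hu : forall l, \sum_m H l m * u m + t * u l + y * n l = 0.
Hypothesis Hv : forall l, \sum_m H l m * v m + t * v l + z * n l = 0.

(** The two equations share the same [t], so [H] acts on the span of [u] and [v] as [- t] modulo
    [n], and the multiple of [n] disappears when paired with a tangent vector. *)
Lemma tangent_form_scalar w w' : dot w n = 0 -> dot w' n = 0 ->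
  \sum_l \sum_m w l * H l m * w' m = - t * dot w w'.
Proof.
move=> wn w'n; have [b [c E]] := tangent_span w'n.
have Hw' l : \sum_m H l m * w' m = - t * w' l - (b * y + c * z) * n l.
  have -> : \sum_m H l m * w' m =
      b * (\sum_m H l m * u m) + c * (\sum_m H l m * v m).
    by rewrite !mulr_sumr -big_split; apply: eq_bigr => m _; rewrite /= E; ring.
  have /eqP := Hu l; rewrite -addrA addr_eq0 => /eqP ->.
  have /eqP := Hv l; rewrite -addrA addr_eq0 => /eqP ->.
  by rewrite E; ring.
transitivity (\sum_l (- t * (w l * w' l) - (b * y + c * z) * (w l * n l))).
  apply: eq_bigr => l _; transitivity (w l * \sum_m H l m * w' m).
    by rewrite mulr_sumr; apply: eq_bigr => m _; rewrite mulrA.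
  by rewrite Hw'; ring.
by rewrite sumrB -!mulr_sumr -/(dot w w') -/(dot w n) wn mulr0 subr0.
Qed.

Lemma tangent_umbilic_minor p q r s : umbilic_minor H n p q r s = 0.
Proof.
rewrite /umbilic_minor /cross_form /cross_gram.
rewrite !tangent_form_scalar; try exact: cross_basis_orth.
by rewrite /dot; ring.
Qed.

End TangentPlane.

Lemma umbilic_minor_real (R : realType) (f : {mpoly R[3]}) x p q r s :
  umbilical_points f x ->
  umbilic_minor (fun l m => hessian f x l m) (fun l => gradient f x l ord0) p q r s = 0.
Proof.
case=> -[x1 la u y] [[x2 la' v y']] [[/= [/= _ e un uu Hu] E1]].
move=> [/= [/= _ _ vn vv Hv] E2] vNu vNNu yy.
rewrite {}E1 in e un Hu; rewrite {}E2 in vn Hv.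
rewrite /cv_y1 /cv_y2 /= in Hu Hv yy.
rewrite !innerE in un uu vn vv.
apply: (@tangent_umbilic_minor _ _ (fun l => u l ord0) (fun l => v l ord0)) => //.
(* The equation [cv_lambda c ^+ 2 * eta f x = 1] excludes a zero gradient. *)
- apply/eqP => n0; move: e; rewrite /eta innerE.
  by rewrite [\sum_l _]n0 mulr0 => /esym/eqP; rewrite oner_eq0.
- by move=> E; apply: vNu; apply/colP => l.
- by move=> E; apply: vNNu; apply/colP => l; rewrite mxE.
- by move=> l; have /colP/(_ l) := Hu; rewrite !mxE; exact.
- by move=> l; have /colP/(_ l) := Hv; rewrite !mxE -yy; exact.
Qed.

(** * Real solutions of the umbilic equations are umbilical points *)

Section DiagQuadricU32.
Variables (R : realType) (a : 'I_3 -> R) (b : R) (x : 'cV[R]_3) (i : 'I_3).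
Hypothesis b_neq0 : b != 0.
Hypothesis x_umbilic : umbilic_on a (fun l => x l ord0) b i.
Let f := diag_quadric a b.
Let j := i + 1.
Let k := i + 2.
Let n l : R := 2 * a l * x l ord0.

(** Where the gradient vanishes, every [a l * z l] is zero, so the polynomial takes the value [- b]
    there. *)
Lemma sing_diag_quadric : sing f = set0.
Proof.
apply/seteqP; split => z //=; rewrite /sing /= complexify_diag_quadric => -[].
rewrite mpeval_diag_quadric => S G.
have az l : (a l)%:C%C * z l ord0 = 0.
  have := G l; rewrite mpeval_mderiv_diag_quadric -mulrA => /eqP.
  by rewrite mulf_eq0 pnatr_eq0 => /eqP.
move: S; rewrite big1 => [|l _]; last by rewrite expr2 mulrA az mul0r.
rewrite sub0r => /eqP; rewrite oppr_eq0 => /eqP.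
by move/(@complexI R) => b0; move: b_neq0; rewrite b0 eqxx.
Qed.

Lemma gradient_diag_quadric l : gradient f x l ord0 = n l.
Proof. by rewrite mxE mpeval_mderiv_diag_quadric. Qed.

Lemma hessian_diag_quadric_mul (u : 'cV[R]_3) l :
  (hessian f x *m u) l ord0 = 2 * a l * u l ord0.
Proof.
rewrite mxE (bigD1 l) //= mxE mpeval_mderiv2_diag_quadric eqxx big1 ?addr0 //.
move=> m /negPf ml; rewrite mxE mpeval_mderiv2_diag_quadric.
by rewrite eq_sym ml mul0r.
Qed.

Lemma umbilic_equationE (w : 'cV[R]_3) t y l :
  (hessian f x *m w + t *: w + y *: gradient f x) l ord0 =
  (2 * a l + t) * w l ord0 + y * n l.
Proof.
have scE c (z : 'cV[R]_3) : (c *: z) l ord0 = c * z l ord0 by rewrite mxE.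
have addE (z1 z2 : 'cV[R]_3) : (z1 + z2) l ord0 = z1 l ord0 + z2 l ord0 by rewrite mxE.
rewrite !addE hessian_diag_quadric_mul !scE gradient_diag_quadric.
by rewrite [(_ * a l + t) * _]mulrDl.
Qed.

Let ni : n i = 0.
Proof. by rewrite /n; case: x_umbilic => ->; rewrite mulr0. Qed.

Let eta_eq : eta f x = n j ^+ 2 + n k ^+ 2.
Proof.
rewrite /eta innerE (big_ord3 _ i) !gradient_diag_quadric ni.
by rewrite mulr0 add0r !expr2.
Qed.

Let eta_gt0 : 0 < eta f x.
Proof.
rewrite eta_eq lt_neqAle addr_ge0 ?sqr_ge0 // andbT eq_sym.
rewrite paddr_eq0 ?sqr_ge0 // !expf_eq0 /= /n -!mulrA !mulf_eq0 pnatr_eq0 /=.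
rewrite -!mulf_eq0; apply/negP => /andP[/eqP ej /eqP ek].
case: x_umbilic => _ S _; move: b_neq0; rewrite -S.
by rewrite !expr2 !mulrA ej ek !mul0r addr0 eqxx.
Qed.

(** On the tangent vector with coordinates [n k], [- n j] in the plane of [j] and [k], the Hessian
    form is [2 * a i] times the metric, just as on the basis vector of index [i]. *)
Let balanced : (a j - a i) * n k ^+ 2 + (a k - a i) * n j ^+ 2 = 0.
Proof.
case: x_umbilic => _ S Q; rewrite -/j -/k in S Q.
have -> : (a j - a i) * n k ^+ 2 + (a k - a i) * n j ^+ 2 =
  4 * ((a j * x j ord0 ^+ 2 + a k * x k ord0 ^+ 2) * (a j * a k) -
       a i * (a j ^+ 2 * x j ord0 ^+ 2 + a k ^+ 2 * x k ord0 ^+ 2)).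
  by rewrite /n; ring.
by rewrite S Q subrr mulr0.
Qed.

Lemma diag_quadric_U32 : U32 (f, x).
Proof.
split; [exact: msize_diag_quadric | exact: sing_diag_quadric |].
(* [s] serves both as [cv_lambda] and as the factor that makes the cross product [v] a unit
   vector. *)
pose s := (Num.sqrt (eta f x))^-1.
have s2 : s ^+ 2 * eta f x = 1.
  by rewrite exprVn sqr_sqrtr ?ltW // mulVf // gt_eqF.
pose mk t y : 'cV[R]_2 := \col_(m < 2) if m == ord0 then t else y.
pose u : 'cV[R]_3 := delta_mx i ord0.
pose v : 'cV[R]_3 := \col_l (s * cross_basis n i l).
have uE : [/\ u i ord0 = 1, u j ord0 = 0 & u k ord0 = 0].
  by rewrite !mxE eqxx /j /k !ord3_neq.
have vE : [/\ v i ord0 = 0, v j ord0 = s * n k & v k ord0 = - (s * n j)].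
  rewrite !mxE; case: (cross_basisE n i) => -> -> ->.
  by rewrite mulr0 mulrN.
case: uE vE => ui uj uk [vi vj vk].
have xX : real_locus f x.
  rewrite /real_locus /= mpeval_diag_quadric (big_ord3 _ i).
  by case: x_umbilic => -> S _; rewrite expr0n mulr0 add0r S subrr.
(* The basis vector [u] is tangent because [n i = 0], and it is an eigenvector of the Hessian. For
   [v] the first multiplier is the same, and the second one cancels the component of the Hessian
   image of [v] along the gradient. *)
exists (CVPoint x s u (mk (- (2 * a i)) 0)).
exists (CVPoint x s v
  (mk (- (2 * a i)) (- (2 * s / eta f x * (a j - a k) * n j * n k)))).
split.
- split=> //; split => //=.
  + by rewrite innerE (big_ord3 _ i) !gradient_diag_quadric ni ui -/j -/k uj uk; ring.
  + by rewrite innerE (big_ord3 _ i) -/j -/k ui uj uk; ring.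
  + rewrite /cv_y1 /cv_y2 !mxE /=.
    apply: (cv3P (i := i)); rewrite umbilic_equationE [RHS]mxE -/j -/k ?ui ?uj ?uk; ring.
- split=> //; split => //=.
  + by rewrite innerE (big_ord3 _ i) !gradient_diag_quadric ni -/j -/k vj vk; ring.
  + rewrite innerE (big_ord3 _ i) -/j -/k vi vj vk.
    by rewrite -[RHS]s2 eta_eq; ring.
  + rewrite /cv_y1 /cv_y2 !mxE /=.
    apply: (cv3P (i := i)); rewrite umbilic_equationE [RHS]mxE -/j -/k ?vi ?vj ?vk ?ni.
    * by ring.
    * transitivity (2 * s * n k / eta f x *
        ((a j - a i) * n k ^+ 2 + (a k - a i) * n j ^+ 2)).
        by rewrite eta_eq; field; rewrite -eta_eq gt_eqF.
      by rewrite balanced mulr0.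
    * transitivity (- (2 * s * n j / eta f x *
        ((a j - a i) * n k ^+ 2 + (a k - a i) * n j ^+ 2))).
        by rewrite eta_eq; field; rewrite -eta_eq gt_eqF.
      by rewrite balanced mulr0 oppr0.
- move=> /= E; have := congr1 (fun w : 'cV[R]_3 => w i ord0) E.
  by rewrite /= vi ui => /esym/eqP; rewrite oner_eq0.
- move=> /= E; have := congr1 (fun w : 'cV[R]_3 => w i ord0) E.
  by rewrite /= vi mxE ui => /eqP; rewrite eq_sym oppr_eq0 oner_eq0.
- by rewrite /cv_y1 /= !mxE.
Qed.

End DiagQuadricU32.

Local Open Scope classical_set_scope.

(** * Zariski closures, curves and polynomial functions *)

Lemma rmorph_mmap n (R : nzRingType) (S T : comNzRingType) (g : {rmorphism S -> T})
    (f : R -> S) (h : 'I_n -> S) (p : {mpoly R[n]}) :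
  g (mmap f h p) = mmap (g \o f) (g \o h) p.
Proof.
rewrite /mmap rmorph_sum; apply: eq_bigr => m _.
rewrite rmorphM /mmap1 rmorph_prod; congr (_ * _).
by apply: eq_bigr => i _; rewrite rmorphXn.
Qed.

Lemma eq_mmap n (R S : nzRingType) (f1 f2 : R -> S) (h1 h2 : 'I_n -> S) :
  f1 =1 f2 -> h1 =1 h2 -> mmap f1 h1 =1 mmap f2 h2.
Proof.
move=> ef eh p; apply: eq_bigr => m _; rewrite ef; congr (_ * _).
by apply: eq_bigr => i _; rewrite eh.
Qed.

Lemma poly_nat_roots_eq0 (F : numFieldType) (p : {poly F}) :
  (forall k : nat, p.[k%:R] = 0) -> p = 0.
Proof.
move=> p0; apply/eqP/negPn/negP => pn0.
have := max_poly_roots pn0 (rs := [seq k%:R | k <- iota 0 (size p)]).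
rewrite size_map size_iota ltnn => H; suff: false by [].
apply: H; first by apply/allP => _ /mapP[k _ ->]; rewrite /root p0.
rewrite map_inj_uniq ?iota_uniq // => k l /eqP.
by rewrite eqr_nat => /eqP.
Qed.

(* On a polynomial curve, a polynomial that vanishes at all but finitely many
   natural parameters vanishes identically. *)
Lemma zariski_closure_curve (F : numFieldType) n (A : set 'cV[F]_n)
    (h : 'I_n -> {poly F}) (q : {poly F}) (z : F) :
    (forall k : nat, q.[k%:R] != 0 -> A (\col_i (h i).[k%:R])) ->
    q.[z] != 0 ->
  zariski_closure A (\col_i (h i).[z]).
Proof.
move=> hA qz _ [S ->] AS p Sp.
pose P := mmap polyC h p.
have PE t : P.[t] = mpeval p (\col_i (h i).[t]).
  rewrite -/(horner_eval t P) rmorph_mmap; apply: eq_mmap => i /=.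
    by rewrite /horner_eval hornerC.
  by rewrite mxE.
(* The factor [q] takes care of the exceptional parameters, at which nothing is known about [P]. *)
have Pq0 : P * q = 0.
  apply: poly_nat_roots_eq0 => k; rewrite hornerM.
  have [->|qk] := eqVneq q.[k%:R] 0; first exact: mulr0.
  by rewrite PE (AS _ (hA k qk)) // mul0r.
rewrite -PE; apply: (mulIf qz).
by rewrite mul0r -hornerM Pq0 horner0.
Qed.

Section PolynomialFunctions.
Variables (F : fieldType) (n : nat).
Implicit Types g h : 'cV[F]_n -> F.

(** Working with functions lets the minors be recognized as polynomial by closure under the ring
    operations, with no explicit polynomial. *)
Definition polyfun g : Prop := exists p, forall x, mpeval p x = g x.

Lemma polyfun_ext g h : g =1 h -> polyfun g -> polyfun h.
Proof. by move=> E [p Hp]; exists p => x; rewrite Hp. Qed.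

Lemma polyfun_const c : polyfun (fun=> c).
Proof. by exists c%:MP => x; rewrite /mpeval mevalC. Qed.

Lemma polyfun_coord i : polyfun (fun x => x i ord0).
Proof. by exists 'X_i => x; rewrite /mpeval mevalXU. Qed.

Lemma polyfunD g h : polyfun g -> polyfun h -> polyfun (fun x => g x + h x).
Proof. by move=> [p Hp] [q Hq]; exists (p + q) => x; rewrite -Hp -Hq /mpeval mevalD. Qed.

Lemma polyfunM g h : polyfun g -> polyfun h -> polyfun (fun x => g x * h x).
Proof. by move=> [p Hp] [q Hq]; exists (p * q) => x; rewrite -Hp -Hq /mpeval mevalM. Qed.

Lemma polyfunN g : polyfun g -> polyfun (fun x => - g x).
Proof. by move=> [p Hp]; exists (- p) => x; rewrite -Hp /mpeval mevalN. Qed.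

Lemma polyfun_sum (I : Type) (r : seq I) (g : I -> 'cV[F]_n -> F) :
  (forall i, polyfun (g i)) -> polyfun (fun x => \sum_(i <- r) g i x).
Proof.
move=> Hg; elim: r => [|i r IH].
  by apply: polyfun_ext (polyfun_const 0) => x; rewrite big_nil.
by apply: polyfun_ext (polyfunD (Hg i) IH) => x; rewrite big_cons.
Qed.

Lemma polyfun_closure (A : set 'cV[F]_n) g :
  polyfun g -> (forall x, A x -> g x = 0) ->
  forall x, zariski_closure A x -> g x = 0.
Proof.
move=> [p Hp] A0 x; rewrite /zariski_closure /= => Ax; rewrite -Hp.
have cl : zariski_closed [set y | forall p', [set p] p' -> mpeval p' y = 0].
  by exists [set p].
by apply: (Ax _ cl) => [y Ay _ ->|]; rewrite ?Hp ?A0.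
Qed.

Lemma polyfun_minor (H : 'cV[F]_n -> 'I_3 -> 'I_3 -> F) (N : 'cV[F]_n -> 'I_3 -> F) :
    (forall l m, polyfun (fun v => H v l m)) ->
    (forall l, polyfun (fun v => N v l)) ->
  forall p q r s, polyfun (fun v => umbilic_minor (H v) (N v) p q r s).
Proof.
move=> HH HN.
have HB p l : polyfun (fun v => cross_basis (N v) p l).
  rewrite /cross_basis; case: eqP => _; first exact: HN.
  by case: eqP => _; [exact/polyfunN/HN | exact: polyfun_const].
have HF p q : polyfun (fun v => cross_form (H v) (N v) p q).
  by do 2!(apply: polyfun_sum => ?); do 2!(apply: polyfunM => //).
have HG p q : polyfun (fun v => cross_gram (N v) p q).
  by apply: polyfun_sum => ?; apply: polyfunM.
by move=> p q r s; apply: polyfunD; last apply: polyfunN; apply: polyfunM.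
Qed.

End PolynomialFunctions.

(** * Coordinates on pairs of a polynomial and a point *)

Section PairCoordinates.
Variable F : fieldType.
Notation N := (#|{: 'X_{1..3 < 3}}| + 3)%N.

Definition poly_of_coords (v : 'cV[F]_N) : {mpoly F[3]} :=
  \sum_j v (lshift 3 j) ord0 *: 'X_[(enum_val j : 'X_{1..3 < 3})].

Lemma pair_coordsK (f : {mpoly F[3]}) x :
  (msize f <= 3)%N -> poly_of_coords (pair_coords f x) = f.
Proof.
move=> fs; rewrite [RHS](mpolywE fs).
rewrite [RHS](reindex_onto enum_val enum_rank) => [|m _]; last first.
  exact: enum_rankK.
apply: eq_big => [j|j _]; first by rewrite enum_valK eqxx.
by rewrite /pair_coords col_mxEu mxE.
Qed.

Lemma polyfun_point (q : {mpoly F[3]}) :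
  polyfun (fun v : 'cV[F]_N => mpeval q (dsubmx v)).
Proof.
exists (mmap (@mpolyC _ _) (fun i => 'X_(rshift _ i)) q) => v.
rewrite /mpeval rmorph_mmap; apply: eq_mmap => i /=; first exact: mevalC.
by rewrite mevalXU mxE.
Qed.

(** The value is linear in the coefficients, with factors polynomial in the point. A general [D]
    covers the polynomial itself and its derivatives of both orders. *)
Lemma polyfun_jet (D : {linear {mpoly F[3]} -> {mpoly F[3]}}) :
  polyfun (fun v : 'cV[F]_N => mpeval (D (poly_of_coords v)) (dsubmx v)).
Proof.
apply: (@polyfun_ext _ _ (fun v => \sum_j v (lshift 3 j) ord0 *
  mpeval (D 'X_[(enum_val j : 'X_{1..3 < 3})]) (dsubmx v))).
  move=> v; rewrite /poly_of_coords linear_sum /mpeval raddf_sum /=.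
  by apply: eq_bigr => j _; rewrite linearZ /= mevalZ.
apply: polyfun_sum => j; apply: polyfunM; first exact: polyfun_coord.
exact: polyfun_point.
Qed.

End PairCoordinates.

Section Complexification.
Variable R : realType.
Implicit Types (f : {mpoly R[3]}) (x : 'cV[R]_3).

Lemma mpeval_complexify f x :
  mpeval (complexify_poly f) (complexify_point x) = (mpeval f x)%:C%C.
Proof.
rewrite /mpeval /complexify_poly /map_mpoly 2!rmorph_mmap.
by apply: eq_mmap => i /=; rewrite ?mevalC // mevalXU mxE.
Qed.

Lemma mderiv_complexify f l : (complexify_poly f)^`M(l) = complexify_poly f^`M(l).
Proof.
by apply/mpolyP => m; rewrite mcoeff_mderiv !mcoeff_map_mpoly /= mcoeff_mderiv raddfMn.
Qed.

Lemma msize_complexify f : msize (complexify_poly f) = msize f.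
Proof. by rewrite !msizeE (perm_big _ (msupp_map_mpoly _ (@complexI R))). Qed.

End Complexification.

Section CurveOfDiagQuadrics.
Variables (F : fieldType) (a x : 'I_3 -> {poly F}) (b : {poly F}).
Notation N := (#|{: 'X_{1..3 < 3}}| + 3)%N.

(** A moving diagonal quadric with a moving point, written coordinate by coordinate in the order of
    [pair_coords], the form that [zariski_closure_curve] takes. *)
Definition diag_quadric_curve (i : 'I_N) : {poly F} :=
  match fintype.split i with
  | inl j => let m := (enum_val j : 'X_{1..3 < 3}) in
      \sum_l a l * (('X_l ^+ 2 : {mpoly F[3]})@_m)%:P
      - b * ((m == 0%MM :> 'X_{1..3})%:R)%:P
  | inr l => x l
  end.

Lemma diag_quadric_curveE t :
  \col_i (diag_quadric_curve i).[t] =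
  pair_coords (diag_quadric (fun l => (a l).[t]) b.[t]) (\col_l (x l).[t]).
Proof.
apply/colP => i; rewrite mxE /diag_quadric_curve /pair_coords.
rewrite -[in RHS](fintype.splitK i); case: (fintype.split i) => j /=; last first.
  by rewrite col_mxEd mxE.
rewrite col_mxEu mxE /diag_quadric mcoeffB mcoeffC hornerD hornerN hornerM hornerC.
rewrite horner_sum raddf_sum /=; congr (_ - _); apply: eq_bigr => l _.
by rewrite hornerM hornerC mcoeffZ.
Qed.

End CurveOfDiagQuadrics.

Lemma rmorph_umbilic_minor (F K : comNzRingType) (g : {rmorphism F -> K}) H n p q r s :
  umbilic_minor (fun l m => g (H l m)) (fun l => g (n l)) p q r s =
  g (umbilic_minor H n p q r s).
Proof.
have B u v : cross_basis (fun l => g (n l)) u v = g (cross_basis n u v).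
  by rewrite /cross_basis; case: eqP => _ //; case: eqP => _; rewrite ?rmorphN ?rmorph0.
have M u v :
    cross_form (fun l m => g (H l m)) (fun l => g (n l)) u v = g (cross_form H n u v).
  rewrite rmorph_sum; apply: eq_bigr => l _; rewrite rmorph_sum.
  by apply: eq_bigr => m _; rewrite !rmorphM !B.
have G u v : cross_gram (fun l => g (n l)) u v = g (cross_gram n u v).
  by rewrite rmorph_sum; apply: eq_bigr => l _; rewrite rmorphM !B.
by rewrite /umbilic_minor rmorphB !rmorphM !M !G.
Qed.

(** * The complex umbilical points as solutions of the umbilic equations *)

Section GeneralQuadric.
Variables (R : realType) (a : 'cV[R]_3).
Hypothesis a_neq0 : forall i, a i ord0 != 0.
Hypothesis a_inj : injective (fun i => a i ord0).
Let ar l : R := a l ord0.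
Let ac l : R[i] := (a l ord0)%:C%C.

Let ac_neq0 i : ac i != 0.
Proof. by rewrite /ac fmorph_eq0. Qed.

Let ac_inj : injective ac.
Proof. by move=> i j /(@complexI R)/a_inj. Qed.

Let complexify_quadric : complexify_poly (quadric a) = diag_quadric ac 1.
Proof. by rewrite quadricE complexify_diag_quadric rmorph1. Qed.

Lemma complex_umbilical_sub z : complex_umbilical_points (quadric a) z ->
  exists i, umbilic_on ac (fun l => z l ord0) 1 i.
Proof.
rewrite /complex_umbilical_points /= => Uz.
have coordsE f : (msize f <= 3)%N -> forall y : 'cV[R[i]]_3,
    poly_of_coords (pair_coords (complexify_poly f) y) = complexify_poly f.
  by move=> fs y; apply: pair_coordsK; rewrite msize_complexify.
have qs : (msize (quadric a) <= 3)%N by rewrite quadricE msize_diag_quadric.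
apply: umbilic_on_of_minors => //.
- move=> p q r s.
  pose Hv v l m := mpeval (poly_of_coords v)^`M(l)^`M(m) (dsubmx v) : R[i].
  pose Nv v l := mpeval (poly_of_coords v)^`M(l) (dsubmx v) : R[i].
  have PH l m : polyfun (fun v => Hv v l m).
    by exact: (polyfun_jet (mderiv m \o mderiv l)).
  have PN l : polyfun (fun v => Nv v l) by exact: (polyfun_jet (mderiv l)).
  have := polyfun_closure (polyfun_minor PH PN p q r s) _ Uz.
  have -> : Nv (pair_coords (complexify_poly (quadric a)) z) =
      fun l => 2 * ac l * z l ord0.
    apply/funext => l; rewrite /Nv coordsE // col_mxKd complexify_quadric.
    exact: mpeval_mderiv_diag_quadric.
  have -> : Hv (pair_coords (complexify_poly (quadric a)) z) =
      fun l m => (2 * ac l) *+ (l == m).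
    apply/funext => l; apply/funext => m.
    rewrite /Hv coordsE // col_mxKd complexify_quadric.
    exact: mpeval_mderiv2_diag_quadric.
  apply=> _ [[f x] [/= fs _ Ux] <-].
  have -> : Nv (pair_coords (complexify_poly f) (complexify_point x)) =
      fun l => (gradient f x l ord0)%:C%C.
    apply/funext => l; rewrite /Nv coordsE // col_mxKd mderiv_complexify.
    by rewrite mpeval_complexify mxE.
  have -> : Hv (pair_coords (complexify_poly f) (complexify_point x)) =
      fun l m => (hessian f x l m)%:C%C.
    apply/funext => l; apply/funext => m.
    rewrite /Hv coordsE // col_mxKd !mderiv_complexify.
    by rewrite mpeval_complexify mxE.
  by rewrite rmorph_umbilic_minor umbilic_minor_real ?rmorph0.
(* The value of the polynomial at the point also vanishes on the closure, which puts [z] on the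
   quadric. *)
- have := polyfun_closure (polyfun_jet idfun) _ Uz.
  rewrite /= coordsE // col_mxKd complexify_quadric mpeval_diag_quadric.
  move=> H; apply/eqP; rewrite -subr_eq0 H // => _ [[f x] [/= fs _ Ux] <-].
  rewrite coordsE // col_mxKd mpeval_complexify.
  case: Ux => c [c' [[[H1 _ _ _ _] <-] _ _ _ _]].
  by rewrite H1 rmorph0.
Qed.

(* The curve is the family of quadrics with [a_i], [a_j], [a_k] proportional to
   [a_j a_k / G], [a_j / E], [a_k / E], cleared of denominators and normalized
   so that it passes through [quadric a] at ['i]. *)
Lemma sub_complex_umbilical (z : 'cV[R[i]]_3) i : umbilic_on ac (fun l => z l ord0) 1 i ->
  complex_umbilical_points (quadric a) z.
Proof.
move=> [zi z1 z2].
pose j := i + 1; pose k := i + 2.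
pose x l : {poly R} := (complex.Re (z l ord0))%:P + (complex.Im (z l ord0)) *: 'X.
pose E : {poly R} := ar j *: x j ^+ 2 + ar k *: x k ^+ 2.
pose G : {poly R} := ar j ^+ 2 *: x j ^+ 2 + ar k ^+ 2 *: x k ^+ 2.
(* At ['i] the umbilic equations of [z] give [E] the value 1 and [G] the value [a_j a_k / a_i]; the
   scalars in [B] and [A] are chosen to match. *)
pose B : {poly R} := (ar i / (ar j * ar k)) *: (E * G).
pose A l : {poly R} := if l == i then ar i *: E
  else if l == j then (ar i / ar k) *: G else (ar i / ar j) *: G.
pose toC := map_poly (real_complex R).
pose ev p : R[i] := (toC p).['i%C].
have evD p q : ev (p + q) = ev p + ev q by rewrite /ev /toC rmorphD hornerD.
have evM p q : ev (p * q) = ev p * ev q by rewrite /ev /toC rmorphM hornerM.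
have evZ c p : ev (c *: p) = c%:C%C * ev p by rewrite /ev /toC map_polyZ hornerZ.
have evx l : ev (x l) = z l ord0.
  rewrite evD evZ /ev /toC map_polyC map_polyX hornerC hornerX.
  by rewrite [RHS]complexE mulrC.
have evE : ev E = 1 by rewrite evD !evZ !expr2 !evM !evx -!expr2.
have [A0 A1 A2] := And3 (ac_neq0 i) (ac_neq0 j) (ac_neq0 k).
have evG : ev G = ac j * ac k / ac i.
  apply: (mulfI A0); rewrite [RHS]mulrC divfK // -[RHS]mul1r -z2.
  by rewrite evD !evZ !expr2 !evM !evx -!expr2 !rmorphXn.
have evB : ev B = 1.
  rewrite evZ evM evE evG !(rmorphM, fmorphV) -!/(ac _).
  by field; rewrite ?A0 ?A1 ?A2.
have evA l : ev (A l) = ac l.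
  move: l; apply: (@ord3_ind _ i); rewrite /A /j ?ord3_neq ?eqxx -/j -/k ?eqxx evZ.
  - by rewrite evE mulr1.
  - by rewrite evG rmorphM fmorphV -!/(ac _); field; rewrite ?A0 ?A1 ?A2.
  - by rewrite evG rmorphM fmorphV -!/(ac _); field; rewrite ?A0 ?A1 ?A2.
rewrite /complex_umbilical_points /= /U32_closure.
have -> : pair_coords (complexify_poly (quadric a)) z =
    \col_l (diag_quadric_curve (fun l => toC (A l)) (fun l => toC (x l))
                                (toC B) l).['i%C].
  rewrite diag_quadric_curveE complexify_quadric; congr pair_coords; last first.
    by apply/colP => l; rewrite mxE -/(ev _) evx.
  by rewrite -/(ev B) evB; congr diag_quadric; apply/funext => l; rewrite -evA.
(* The parameters to avoid are the roots of [B], since a nonzero constant term is what keeps the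
   quadric nonsingular. *)
apply: (@zariski_closure_curve _ _ _ _ (toC B)); last by rewrite -/(ev B) evB oner_neq0.
have toCE p (n : nat) : (toC p).[n%:R] = (p.[n%:R])%:C%C.
  by rewrite -(rmorph_nat (real_complex R)) horner_map.
move=> n; rewrite toCE fmorph_eq0 => Bn.
exists (diag_quadric (fun l => (A l).[n%:R]) B.[n%:R], \col_l (x l).[n%:R]); last first.
  rewrite diag_quadric_curveE /= complexify_diag_quadric; congr pair_coords.
    by rewrite toCE; congr diag_quadric; apply/funext => l; rewrite toCE.
  by apply/colP => l; rewrite !mxE toCE.
(* By the choice of [A] and [B] the umbilic equations hold identically along the curve. *)
apply: (@diag_quadric_U32 _ _ _ _ i) => //; split.
- by rewrite mxE /x zi /= scale0r addr0 hornerC.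
- rewrite !mxE /A /j !ord3_neq ?eqxx -/j -/k ?eqxx /B /E !(hornerZ, hornerM, hornerD).
  by rewrite /= ?expr2 ?hornerM; field; rewrite !a_neq0.
- rewrite !mxE /A /j !ord3_neq ?eqxx -/j -/k ?eqxx /B /E /G !(hornerZ, hornerM, hornerD).
  by rewrite /= ?expr2 ?hornerM; field; rewrite !a_neq0.
Qed.

End GeneralQuadric.

(** * Enumeration of the points by sign choices *)

Section UmbilicPoints.
Variable F : numFieldType.

Definition umbilic_pt (i : 'I_3) (s t : F) (e : bool * bool) : 'cV[F]_3 :=
  \col_l (if l == i + 1 then (-1) ^+ e.1 * s
          else if l == i + 2 then (-1) ^+ e.2 * t else 0).

Lemma umbilic_ptE i s t e :
  [/\ umbilic_pt i s t e i ord0 = 0,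
      umbilic_pt i s t e (i + 1) ord0 = (-1) ^+ e.1 * s
    & umbilic_pt i s t e (i + 2) ord0 = (-1) ^+ e.2 * t].
Proof. by rewrite !mxE !ord3_neq !eqxx. Qed.

(** The position of the zero coordinate recovers [i], so points of different coordinate planes never
    coincide. *)
Lemma umbilic_pt_eq0 i s t e l : s != 0 -> t != 0 ->
  (umbilic_pt i s t e l ord0 == 0) = (l == i).
Proof.
move=> s0 t0; move: l; case: (umbilic_ptE i s t e) => E0 E1 E2.
apply: (@ord3_ind _ i); rewrite ?E0 ?E1 ?E2 ?eqxx // mulf_eq0 signr_eq0 /=.
- by rewrite (negPf s0) ord3_neq.
- by rewrite (negPf t0) ord3_neq.
Qed.

Lemma umbilic_pt_inj i s t : s != 0 -> t != 0 -> injective (umbilic_pt i s t).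
Proof.
move=> s0 t0 [b c] [b' c'] E.
case: (umbilic_ptE i s t (b, c)) (umbilic_ptE i s t (b', c')) => _ E1 E2 [_ E1' E2'].
have /(mulIf s0)/signr_inj -> : (-1) ^+ b * s = (-1) ^+ b' * s by rewrite -E1 -E1' E.
by have /(mulIf t0)/signr_inj -> : (-1) ^+ c * t = (-1) ^+ c' * t by rewrite -E2 -E2' E.
Qed.

Lemma umbilic_ptP i s t (x : 'cV[F]_3) :
  [/\ x i ord0 = 0, x (i + 1) ord0 ^+ 2 = s ^+ 2 & x (i + 2) ord0 ^+ 2 = t ^+ 2]
  <-> exists e, umbilic_pt i s t e = x.
Proof.
split=> [[x0 x1 x2]|[e <-]]; last first.
  by case: (umbilic_ptE i s t e) => -> -> ->; rewrite !exprMn !sqrr_sign !mul1r.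
have sq (y r : F) : y ^+ 2 = r ^+ 2 -> exists b : bool, (-1) ^+ b * r = y.
  move/eqP; rewrite eqf_sqr => /orP[]/eqP ->; first by exists false; rewrite mul1r.
  by exists true; rewrite mulN1r.
have [b Hb] := sq _ _ x1; have [c Hc] := sq _ _ x2; exists (b, c).
case: (umbilic_ptE i s t (b, c)) => E0 E1 E2.
by apply: (cv3P (i := i)); rewrite ?E0 ?E1 ?E2 ?x0.
Qed.

End UmbilicPoints.

Lemma card_range_fin (T : finType) U (f : T -> U) :
  injective f -> (range f #= `I_#|T|)%card.
Proof.
move=> f_inj; have -> : range f = range (fun k : 'I_#|T| => f (enum_val k)).
  apply/seteqP; split => _ [x _ <-]; last by exists (enum_val x).
  by exists (enum_rank x) => //; rewrite enum_rankK.
apply: card_eq_trans (card_esym card_II); apply: inj_card_eq => k l _ _ /f_inj.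
exact: enum_val_inj.
Qed.

(** * Signs of the squared coordinates *)

Section MiddleCoefficient.
Variables (F : realFieldType) (a : 'I_3 -> F).
Hypothesis a_neq0 : forall i, a i != 0.
Hypothesis a_inj : injective a.

Definition middle i := (a (i + 1) - a i) * (a (i + 2) - a i) < 0.

Let sqr_sub_gt0 k l : (k == l) = false -> 0 < (a k - a l) ^+ 2.
Proof.
by move=> kl; rewrite lt_neqAle sqr_ge0 andbT eq_sym sqrf_eq0 subr_eq0 (inj_eq a_inj) kl.
Qed.

(** In the product of the three expressions each difference occurs twice with opposite signs, so the
    product is minus a product of nonzero squares. *)
Lemma middle_exists : exists i, middle i.
Proof.
apply: contrapT => N.
have ge0 i : 0 <= (a (i + 1) - a i) * (a (i + 2) - a i).
  by rewrite leNgt; apply/negP => H; apply: N; exists i.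
have := mulr_ge0 (mulr_ge0 (ge0 0) (ge0 (0 + 1))) (ge0 (0 + 2)); rewrite !ord3_add.
have H1 : 0 < (a (0 + 1) - a 0) ^+ 2 by rewrite sqr_sub_gt0.
have H2 : 0 < (a (0 + 2) - a 0) ^+ 2 by rewrite sqr_sub_gt0.
have H3 : 0 < (a (0 + 2) - a (0 + 1)) ^+ 2 by rewrite sqr_sub_gt0.
rewrite leNgt => /negP; apply; have := mulr_gt0 (mulr_gt0 H1 H2) H3.
by rewrite -oppr_lt0; congr (_ < 0); ring.
Qed.

(** For [i] and [j] different, the two negative expressions would add up to the square of
    [a j - a i]. *)
Lemma middle_uniq i j : middle i -> middle j -> i = j.
Proof.
rewrite /middle => Hi; move: j; apply: (@ord3_ind _ i) => //; rewrite !ord3_add => Hj.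
- have : 0 < (a (i + 1) - a i) ^+ 2 by rewrite sqr_sub_gt0 ?ord3_neq.
  have -> : (a (i + 1) - a i) ^+ 2 = (a (i + 1) - a i) * (a (i + 2) - a i) +
    (a (i + 2) - a (i + 1)) * (a i - a (i + 1)) by ring.
  by rewrite ltNge ltW // -[0]addr0 ltrD.
- have : 0 < (a (i + 2) - a i) ^+ 2 by rewrite sqr_sub_gt0 ?ord3_neq.
  have -> : (a (i + 2) - a i) ^+ 2 = (a (i + 1) - a i) * (a (i + 2) - a i) +
    (a i - a (i + 2)) * (a (i + 1) - a (i + 2)) by ring.
  by rewrite ltNge ltW // -[0]addr0 ltrD.
Qed.

(** Multiplying by the squared denominators reduces the two signs to those of [P * (b * (b - c))]
    and [P * (c * (c - b))], whose product is [- (P * (b - c)) ^+ 2 * (b * c)]. Both being positive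
    forces [b * c < 0], and then [b * (b - c)] and [c * (c - b)] are positive, which leaves the sign
    of [P]. *)
Lemma umbilic_sqr_gt0 i :
  (0 < (umbilic_sqr a i).1) && (0 < (umbilic_sqr a i).2) =
  middle i && (0 < a i * a (i + 1) * a (i + 2)).
Proof.
set P := a i * a (i + 1) * a (i + 2).
have A0 := a_neq0 i; have A1 := a_neq0 (i + 1); have A2 := a_neq0 (i + 2).
have D12 : a (i + 1) - a (i + 2) != 0 by rewrite subr_eq0 (inj_eq a_inj) ord3_neq.
have D21 : a (i + 2) - a (i + 1) != 0 by rewrite subr_eq0 (inj_eq a_inj) ord3_neq.
pose b := a (i + 1) - a i; pose c := a (i + 2) - a i.
have sq_gt0 (x y z : F) : y != 0 -> x = z / y ^+ 2 -> (0 < x) = (0 < z).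
  move=> y0 ->; rewrite pmulr_lgt0 // invr_gt0 lt_neqAle sqr_ge0 andbT eq_sym.
  by rewrite expf_eq0.
have -> : (0 < (umbilic_sqr a i).1) = (0 < P * (b * (b - c))).
  apply: (sq_gt0 _ (a (i + 1) * a i * (a (i + 1) - a (i + 2)))).
    by rewrite !mulf_neq0.
  by rewrite /umbilic_sqr /P /b /c /=; field; rewrite A0 A1 D12.
have -> : (0 < (umbilic_sqr a i).2) = (0 < P * (c * (c - b))).
  apply: (sq_gt0 _ (a (i + 2) * a i * (a (i + 2) - a (i + 1)))).
    by rewrite !mulf_neq0.
  by rewrite /umbilic_sqr /P /b /c /=; field; rewrite A0 A2 D21.
rewrite /middle -/b -/c.
apply/idP/idP => /andP[H1 H2].
  have bc : b * c < 0.
    rewrite ltNge; apply/negP => bc.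
    have := mulr_gt0 H1 H2; rewrite ltNge => /negP; apply; rewrite -oppr_ge0.
    have -> : - (P * (b * (b - c)) * (P * (c * (c - b)))) =
      (P * (b - c)) ^+ 2 * (b * c) by ring.
    by rewrite mulr_ge0 ?sqr_ge0.
  rewrite bc /= ltNge; apply/negP => P0.
  move: H1; rewrite ltNge => /negP; apply.
  rewrite mulr_le0_ge0 // mulrBr subr_ge0 -expr2 (le_trans (ltW bc)) ?sqr_ge0 //.
apply/andP; split; apply: mulr_gt0 => //.
  by rewrite mulrBr subr_gt0 -expr2 (lt_le_trans H1) ?sqr_ge0.
by rewrite mulrBr subr_gt0 -expr2 mulrC (lt_le_trans H1) ?sqr_ge0.
Qed.

End MiddleCoefficient.

Lemma prod_ord3 (F : comPzRingType) (a : 'I_3 -> F) i :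
  a i * a (i + 1) * a (i + 2) = a 0 * a (0 + 1) * a (0 + 2).
Proof.
have i3 : [|| i == 0, i == 0 + 1 | i == 0 + 2] by move: i; case=> -[|[|[|?]]].
by case/or3P: i3 => /eqP ->; rewrite ?ord3_add //; ring.
Qed.

(** The sign of the product is the parity of the number of negative coefficients; the eight sign
    patterns are checked one by one. *)
Lemma quadric_type_sign (R : realType) (a : 'cV[R]_3) i :
    (forall i, a i ord0 != 0) ->
  (ellipsoid a \/ two_sheeted_hyperboloid a ->
     0 < a i ord0 * a (i + 1) ord0 * a (i + 2) ord0) /\
  (one_sheeted_hyperboloid a \/ empty_quadric a ->
     a i ord0 * a (i + 1) ord0 * a (i + 2) ord0 < 0).
Proof.
move=> a0; rewrite (prod_ord3 (fun l => a l ord0)).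
rewrite -[0 < _ * _]sgr_gt0 -[_ * _ < 0]sgr_lt0 !sgrM.
have cardE (p : pred 'I_3) : #|[set l | p l]%SET| = (p 0%R + p (0 + 1)%R + p (0 + 2)%R)%N.
  by rewrite cardsE -sum1_card big_mkcond /= (big_ord3 _ 0) !unfold_in;
    do 3!case: (p _).
rewrite /ellipsoid /two_sheeted_hyperboloid /one_sheeted_hyperboloid /empty_quadric.
rewrite /num_pos /num_neg !cardE.
have sg l : (0 < a l ord0) /\ (a l ord0 < 0) = false /\ Num.sg (a l ord0) = 1 \/
  (0 < a l ord0) = false /\ (a l ord0 < 0) /\ Num.sg (a l ord0) = -1.
  have := a0 l; case: ltrgt0P => // H _; [left|right]; split => //; split=> //.
  - exact: gtr0_sg.
  - exact: ltr0_sg.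
by case: (sg 0) => -[-> [-> ->]]; case: (sg (0 + 1)) => -[-> [-> ->]];
  case: (sg (0 + 2)) => -[-> [-> ->]]; split=> H;
  first [by case: H => [|[]] | by case: H => [[]|]
        | by rewrite ?(mulrN, mulNr, mulr1, opprK) ?oppr_lt0 ?ltr01].
Qed.

(** * Counting the umbilical points *)

Section UmbilicCount.
Variables (R : realType) (a : 'cV[R]_3).
Hypothesis a_neq0 : forall i, a i ord0 != 0.
Hypothesis a_inj : injective (fun i => a i ord0).
Let ar l : R := a l ord0.
Let ac l : R[i] := (a l ord0)%:C%C.

Let ac_neq0 i : ac i != 0.
Proof. by rewrite /ac fmorph_eq0. Qed.

Let ac_inj : injective ac.
Proof. by move=> i j /(@complexI R)/a_inj. Qed.

(** The forward direction is inherited from the complex case: a real umbilical point gives a pair in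
    the closure, and the equations descend because [R] embeds in [R[i]]. *)
Lemma umbilical_quadric x : umbilical_points (quadric a) x <->
  exists i, umbilic_on ar (fun l => x l ord0) 1 i.
Proof.
split=> [Ux|[i Hi]]; last first.
  by have [_ _] := diag_quadric_U32 (oner_neq0 R) Hi; rewrite quadricE.
have Uq : U32 (quadric a, x).
  rewrite quadricE in Ux *; split => //; first exact: msize_diag_quadric.
  exact: sing_diag_quadric (oner_neq0 R).
have [|i [H0 H1 H2]] := @complex_umbilical_sub _ _ a_neq0 a_inj (complexify_point x).
  move=> Z _ UZ; apply: UZ; exists (quadric a, x) => //.
exists i; split; apply: (@complexI R).
- by move: H0; rewrite mxE => ->; rewrite rmorph0.
- by move: H1; rewrite !mxE /ac !expr2 rmorphD !rmorphM rmorph1.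
- by move: H2; rewrite !mxE /ac !expr2 !(rmorphM, rmorphD) rmorph1.
Qed.

Lemma card_complex_umbilical : (complex_umbilical_points (quadric a) #= `I_12)%card.
Proof.
(* Any choice of square roots will do, since all sign combinations are listed. *)
pose s i := sqrtC (umbilic_sqr ac i).1; pose t i := sqrtC (umbilic_sqr ac i).2.
have s0 i : s i != 0 by rewrite sqrtC_eq0; case/andP: (umbilic_sqr_neq0 ac_neq0 ac_inj i).
have t0 i : t i != 0 by rewrite sqrtC_eq0; case/andP: (umbilic_sqr_neq0 ac_neq0 ac_inj i).
pose f (k : 'I_3 * (bool * bool)) := umbilic_pt k.1 (s k.1) (t k.1) k.2.
have -> : complex_umbilical_points (quadric a) = range f.
  apply/seteqP; split => z.
    case/(complex_umbilical_sub a_neq0 a_inj) => i.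
    move/(umbilic_onE ac_neq0 ac_inj (fun l => z l ord0) i) => [z0 z1 z2].
    have /umbilic_ptP[e <-] : [/\ z i ord0 = 0, z (i + 1) ord0 ^+ 2 = s i ^+ 2
        & z (i + 2) ord0 ^+ 2 = t i ^+ 2] by rewrite !sqrtCK.
    by exists (i, e).
  move=> [[i e] _ /= fz]; apply: (sub_complex_umbilical a_neq0 (i := i)).
  have /umbilic_ptP[z0 z1 z2] : exists e, umbilic_pt i (s i) (t i) e = z by exists e.
  apply/(umbilic_onE ac_neq0 ac_inj (fun l => z l ord0) i).
  by rewrite z0 z1 z2 !sqrtCK.
have -> : 12%N = #|{: 'I_3 * (bool * bool)}| by rewrite !card_prod card_ord card_bool.
apply: card_range_fin => -[i e] [i' e'] E.
have ii : i = i'.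
  have := umbilic_pt_eq0 i' e' i (s0 i') (t0 i').
  have /= := congr1 (fun v : 'cV_3 => v i ord0) E; rewrite /f /= => <-.
  by rewrite umbilic_pt_eq0 // eqxx => /esym/eqP.
by subst i'; congr (_, _); apply: umbilic_pt_inj E.
Qed.

(** For real [x] the two entries of [umbilic_sqr] are nonzero squares, hence positive. *)
Lemma real_umbilicP i (x : 'cV[R]_3) : umbilic_on ar (fun l => x l ord0) 1 i ->
  middle ar i && (0 < ar i * ar (i + 1) * ar (i + 2)).
Proof.
move/(umbilic_onE a_neq0 a_inj (fun l => x l ord0) i) => [_ x1 x2].
rewrite -umbilic_sqr_gt0 //.
have /andP[] := umbilic_sqr_neq0 a_neq0 a_inj i.
rewrite -/ar -x1 -x2 => n1 n2.
by rewrite !lt_neqAle !sqr_ge0 !andbT eq_sym n1 eq_sym n2.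
Qed.

Lemma card_umbilical_pos i :
  0 < ar i * ar (i + 1) * ar (i + 2) -> (umbilical_points (quadric a) #= `I_4)%card.
Proof.
rewrite (prod_ord3 ar) => P0.
have [m Hm] := middle_exists a_inj.
have /andP[q1 q2] : (0 < (umbilic_sqr ar m).1) && (0 < (umbilic_sqr ar m).2).
  by rewrite umbilic_sqr_gt0 // Hm (prod_ord3 ar).
pose s := Num.sqrt (umbilic_sqr ar m).1; pose t := Num.sqrt (umbilic_sqr ar m).2.
have -> : umbilical_points (quadric a) = range (umbilic_pt m s t).
  apply/seteqP; split => x.
    move/umbilical_quadric => [j Hj]; have /andP[mj _] := real_umbilicP Hj.
    have E := middle_uniq a_inj Hm mj; subst j.
    move: Hj => /(umbilic_onE a_neq0 a_inj (fun l => x l ord0) m) [x0 x1 x2].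
    have /umbilic_ptP[e <-] : [/\ x m ord0 = 0, x (m + 1) ord0 ^+ 2 = s ^+ 2
        & x (m + 2) ord0 ^+ 2 = t ^+ 2] by rewrite !sqr_sqrtr ?ltW.
    by exists e.
  move=> [e _ xe]; apply/umbilical_quadric; exists m.
  have /umbilic_ptP[x0 x1 x2] : exists e, umbilic_pt m s t e = x by exists e.
  apply/(umbilic_onE a_neq0 a_inj (fun l => x l ord0) m).
  by rewrite x0 x1 x2 !sqr_sqrtr ?ltW.
have -> : 4%N = #|{: bool * bool}| by rewrite card_prod card_bool.
by apply/card_range_fin/umbilic_pt_inj; rewrite sqrtr_eq0 -ltNge.
Qed.

Lemma card_umbilical_neg i :
  ar i * ar (i + 1) * ar (i + 2) < 0 -> (umbilical_points (quadric a) #= `I_0)%card.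
Proof.
rewrite (prod_ord3 ar) => P0; rewrite II0 card_eq0; apply/eqP/seteqP.
split => x // /umbilical_quadric[j /real_umbilicP/andP[_]].
by rewrite (prod_ord3 ar) ltNge (ltW P0).
Qed.

End UmbilicCount.

Theorem theorem4p1 (R : realType) :
  for_general (fun a : 'cV[R]_3 =>
    [/\ (complex_umbilical_points (quadric a) #= `I_12)%card,
        ellipsoid a \/ two_sheeted_hyperboloid a ->
          (umbilical_points (quadric a) #= `I_4)%card
      & one_sheeted_hyperboloid a \/ empty_quadric a ->
          (umbilical_points (quadric a) #= `I_0)%card]).
Proof.
(* Outside the zero set of [p] the coefficients are nonzero and pairwise distinct: the cyclic
   differences cover all three pairs. *)
pose p : {mpoly R[3]} := (\prod_l 'X_l) * \prod_(l < 3) ('X_l - 'X_(l + 1)).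
have pE a : mpeval p a =
    (\prod_l a l ord0) * \prod_(l < 3) (a l ord0 - a (l + 1) ord0).
  rewrite /mpeval mevalM !rmorph_prod; congr (_ * _); apply: eq_bigr => l _ /=.
    by rewrite mevalXU.
  by rewrite mevalB !mevalXU.
exists [set a | mpeval p a = 0]; split.
- exists [set p]; apply/seteqP; split => a /=; last exact.
  by move=> pa _ ->.
(* The point (1, 2, 3) shows that the closed set is proper. *)
- move/seteqP => [_ /(_ (\col_l l.+1%:R) I)] /= /eqP; apply/negP.
  rewrite pE mulf_neq0 //; apply/prodf_neq0 => l _; rewrite ?mxE ?pnatr_eq0 //.
  by rewrite subr_eq0 eqr_nat; move: l; case=> -[|[|[|?]]].
move=> a /= /eqP; rewrite pE mulf_eq0 negb_or => /andP[/prodf_neq0 H0 /prodf_neq0 H1].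
have a0 i : a i ord0 != 0 by exact: H0.
have ai : injective (fun i => a i ord0).
  move=> i; apply: (@ord3_ind _ i) => // E.
    by have := H1 i isT; rewrite E subrr eqxx.
  by have := H1 (i + 2) isT; rewrite ord3_add E subrr eqxx.
have [pos neg] := quadric_type_sign 0 a0.
split; first exact: card_complex_umbilical.
- by move/pos; apply: card_umbilical_pos.
- by move/neg; apply: card_umbilical_neg.
Qed.
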